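(* Let $1\le k\le K$. Given observations $y_1,\dots,y_k\in\mathbb{R}$ and gaslighting efforts (probability density functions) $\phi^\circ_1,\dots,\phi^\circ_k$ on $\mathbb{R}$, let $(\sigma_j)$ and $(\sigma^\circ_j)$ be the original and gaslighted information states generated with the same controls $u_0,\dots,u_{k-1}$ and the same observations $y_1,\dots,y_k$, and let $d_j=d(\sigma^\circ_j,\sigma_j)$. Then, regardless of the controls $u_0,u_1,\dots,u_{k-1}$, $$d_k\;\le\;\frac{c^k d_0}{\prod_{i=1}^{k}\phi(y_i)}+\sum_{j=1}^{k}\frac{c^{\,k-j+1}\,\zeta\, Y_j(y_j)}{\prod_{i=j+1}^{k}\phi(y_i)},$$ where an empty product equals $1$ and $Y_j(y_j)=\left|\frac{1}{\phi^\circ_j(y_j)}-\frac{1}{\phi(y_j)}\right|$.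
   Context: Consider the discrete-time system $x_{k+1}=b(x_k,u_k)+w_k$, $y_{k+1}=h(x_k)+v_k$ over a finite horizon $k=0,\dots,K$, with states in $\mathcal{X}\subset\mathbb{R}^n$ and real observations, where $w_k\in\mathbb{R}^n$ are i.i.d. with density $\psi$, $v_k\in\mathbb{R}$ are i.i.d. with density $\phi$, $v_k$ is independent of $x_0$ and the $w_k$, and the control $u_k$ lies in a compact set $U_k\subset\mathbb{R}^m$. Let $\mu>0$ be a risk-sensitivity parameter and $L(x,u)$ a real running cost. Original information states: $\sigma_{k+1}(z)=\int_{\mathbb{R}^n}\psi(z-b(\xi,u_k))\,e^{\mu L(\xi,u_k)}\,\frac{\phi(y_{k+1}-h(\xi))}{\phi(y_{k+1})}\,\sigma_k(\xi)\,d\xi$, with $\sigma_0\in L^1(\mathbb{R}^n)$ an initial probability density. Gaslighted information states: $\sigma^\circ_{k+1}(z)=\int_{\mathbb{R}^n}\psi(z-b(\xi,u_k))\,e^{\mu L(\xi,u_k)}\,\frac{\phi(y_{k+1}-h(\xi))}{\phi^\circ_{k+1}(y_{k+1})}\,\sigma^\circ_k(\xi)\,d\xi$, with initial state $\sigma^\circ_0$. The densities appearing in denominators are understood to be nonzero at the observations concerned. Information states are unnormalized densities, i.e. elements of $L^1(\mathbb{R}^n)$, and the metric is $d(\sigma^1,\sigma^2)=\|\sigma^1-\sigma^2\|_{L^1}=\int_{\mathbb{R}^n}|\sigma^1(z)-\sigma^2(z)|\,dz$. Constants (the maxima are assumed to exist and be finite): $\hat\phi=\max_y\phi(y)$; $l=\max_{x,u}e^{\mu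 L(x,u)}$; $c=\hat\phi\, l$; $\zeta>0$ is the maximum $L^1$-norm of all possible information states (over all stages, original and gaslighted). *)

(* Defs.v *)
From HB Require Import structures.
From mathcomp Require Import all_boot all_order all_algebra.
From mathcomp Require Import all_classical all_reals all_analysis.

Set Implicit Arguments.
Unset Strict Implicit.
Unset Printing Implicit Defensive.
Import Order.TTheory GRing.Theory Num.Theory.
Import numFieldNormedType.Exports.

Local Open Scope classical_set_scope.
Local Open Scope ring_scope.

Definition measure_rV_display : measure_display -> measure_display.
Proof. exact. Qed.

(* Row vectors carry the sigma-algebra generated by the coordinates; for
   entries in a [realType] this is the Borel sigma-algebra of R^n. *)
Section measurable_rV.
Context {d} {T : measurableType d}.
Variable n : nat.

Definition rV_coor (i : 'I_n) (x : 'rV[T]_n) : T := x ord0 i.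

Let rV_set0 : g_sigma_preimage rV_coor set0.
Proof. exact: sigma_algebra0. Qed.

Let rV_setC A : g_sigma_preimage rV_coor A -> g_sigma_preimage rV_coor (~` A).
Proof. exact: sigma_algebraC. Qed.

Let rV_bigcup (F : (set 'rV[T]_n)^nat) :
  (forall i, g_sigma_preimage rV_coor (F i)) ->
  g_sigma_preimage rV_coor (\bigcup_i (F i)).
Proof. exact: sigma_algebra_bigcup. Qed.

HB.instance Definition _ := @isMeasurable.Build (measure_rV_display d)
  'rV[T]_n (g_sigma_preimage rV_coor) rV_set0 rV_setC rV_bigcup.

End measurable_rV.

Lemma measurable_rV_coor d (T : measurableType d) n (i : 'I_n) :
  measurable_fun [set: 'rV[T]_n] (rV_coor i).
Proof.
move=> _ Y mY; rewrite setTI; apply: sub_sigma_algebra => /=.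
rewrite -bigcup_seq/=; exists i => /=; first by rewrite mem_index_enum.
by exists Y => //; rewrite setTI.
Qed.

Lemma measurable_fun_rV_coorP d1 d2 (T1 : measurableType d1)
    (T2 : measurableType d2) n (f : T1 -> 'rV[T2]_n) :
  measurable_fun [set: T1] f <->
  forall i, measurable_fun [set: T1] (rV_coor i \o f).
Proof.
split=> [mf i|mf]; first exact: measurableT_comp (measurable_rV_coor i) mf.
have : g_sigma_preimage (fun i => rV_coor i \o f) `<=` measurable.
  apply: smallest_sub; first exact: sigma_algebra_measurable.
  case: n => [|n] in f mf *; first by rewrite big_ord0.
  rewrite -bigcup_mkord_ord; apply: bigcup_sub => i Ii.
  by move=> A [B mB <-]; exact: mf.
by rewrite g_sigma_preimage_comp => prefS _ A mA; apply: prefS; exists A.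
Qed.

Section lebesgue_rV.
Context {R : realType}.

(* [measurableTypeR R] is R with the very same Borel sigma-algebra; it is the
   type on which [lebesgue_measure] is declared. *)
Definition rV_cons n (p : measurableTypeR R * 'rV[R]_n) : 'rV[R]_n.+1 :=
  row_mx (p.1 : R)%:M p.2.

Lemma measurable_rV_cons n : measurable_fun setT (@rV_cons n).
Proof.
apply/measurable_fun_rV_coorP => i.
have [->|i0] := eqVneq i ord0.
  rewrite (_ : _ \o _ = (fun p => p.1)).
    exact: (@measurable_fst _ _ (measurableTypeR R) 'rV[R]_n).
  apply/funext => p /=; rewrite /rV_coor /rV_cons.
  have -> : (ord0 : 'I_n.+1) = lshift n (ord0 : 'I_1) by exact/val_inj.
  by rewrite [LHS](row_mxEl (p.1 : R)%:M p.2) mxE eqxx.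
have i1n : (i.-1 < n)%N by rewrite prednK ?lt0n// -ltnS.
rewrite (_ : _ \o _ = rV_coor (Ordinal i1n) \o snd).
  exact: measurableT_comp (measurable_rV_coor _) measurable_snd.
apply/funext => p /=; rewrite /rV_coor /rV_cons.
rewrite -(row_mxEr (p.1 : R)%:M p.2); congr (row_mx _ _ _ _).
by apply/val_inj/esym/prednK; rewrite lt0n.
Qed.

Section step.
Variables (n : nat) (m : {measure set 'rV[R]_n -> \bar R}).

Definition lebesgue_rV_cons : set 'rV[R]_n.+1 -> \bar R :=
  pushforward (lebesgue_measure \x^ m)%E (@rV_cons n).

Let m0 : lebesgue_rV_cons set0 = 0%E.
Proof. by rewrite /lebesgue_rV_cons /pushforward preimage_set0 measure0. Qed.

Let m_ge0 A : (0 <= lebesgue_rV_cons A)%E.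
Proof. by rewrite /lebesgue_rV_cons /pushforward; exact: measure_ge0. Qed.

Let m_sigma_additive : semi_sigma_additive lebesgue_rV_cons.
Proof.
move=> F mF tF mUF; rewrite /lebesgue_rV_cons /pushforward preimage_bigcup.
have mE A : measurable A -> measurable (@rV_cons n @^-1` A).
  by move=> mA; rewrite -[X in measurable X]setTI; exact: measurable_rV_cons.
apply: measure_semi_sigma_additive.
- by move=> i; exact: mE.
- apply/trivIsetP => i j _ _ ij; rewrite -preimage_setI.
  by move/trivIsetP : tF => /(_ _ _ _ _ ij) ->//; rewrite preimage_set0.
- by rewrite -preimage_bigcup; exact: mE.
Qed.

HB.instance Definition _ := isMeasure.Build _ _ _ lebesgue_rV_cons
  m0 m_ge0 m_sigma_additive.

End step.

(* n-dimensional Lebesgue measure as the iterated product of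
   [lebesgue_measure], transported along [rV_cons]; R^0 is a unit mass. *)
Fixpoint lebesgue_rV (n : nat) : {measure set 'rV[R]_n -> \bar R} :=
  match n with
  | 0 => \d_ (0 : 'rV[R]_0)
  | n'.+1 => lebesgue_rV_cons (lebesgue_rV n')
  end.

End lebesgue_rV.
Arguments lebesgue_rV {R} n.

Definition is_max {d} {T : porderType d} (A : set T) (x : T) : Prop :=
  A x /\ ubound A x.

Definition is_pdf {d} {T : measurableType d} {R : realType}
    (mu : set T -> \bar R) (f : T -> R) : Prop :=
  [/\ measurable_fun [set: T] f, (forall x, 0 <= f x)
    & (\int[mu]_x (f x)%:E = 1)%E].

(* Extended-real valued, so that a non-integrable argument has norm +oo. *)
Definition L1norm {R : realType} {n} (s : 'rV[R]_n -> R) : \bar R :=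
  'N[lebesgue_rV n]_1[EFin \o s]%E.

Definition L1dist {R : realType} {n} (s1 s2 : 'rV[R]_n -> R) : \bar R :=
  L1norm (fun z => s1 z - s2 z).

(* Data of x_{k+1} = b(x_k, u_k) + w_k, y_{k+1} = h(x_k) + v_k, 0 <= k <= K,
   with w_k of density [psi], v_k of density [phi], and u_k in [ctrl k]. *)
Record risk_system (R : realType) (n m : nat) := RiskSystem {
  horizon : nat ;
  dyn : 'rV[R]_n -> 'rV[R]_m -> 'rV[R]_n ;
  obs : 'rV[R]_n -> R ;
  cost : 'rV[R]_n -> 'rV[R]_m -> R ;
  risk : R ;
  psi : 'rV[R]_n -> R ;
  phi : R -> R ;
  ctrl : nat -> set 'rV[R]_m }.

Section information_states.
Context {R : realType} {n m : nat}.
Variable sys : risk_system R n m.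

(* The control values that enter the states at stages 0, ..., K. *)
Definition control_values : set 'rV[R]_m :=
  \bigcup_(i in [set i | (i < horizon sys)%N]) ctrl sys i.

(* One update of an information state; [den] is the density in the
   denominator. *)
Definition info_step (den : R -> R) (u : 'rV[R]_m) (y : R)
    (s : 'rV[R]_n -> R) : 'rV[R]_n -> R :=
  fun z => (\int[lebesgue_rV n]_xi
    (psi sys (z - dyn sys xi u) * expR (risk sys * cost sys xi u)
     * (phi sys (y - obs sys xi) / den y) * s xi))%R.

(* [y i] is the observation and [den i] the denominator density of stage
   i >= 1; the values [y 0] and [den 0] are never used. *)
Fixpoint info_state (den : nat -> R -> R) (u : nat -> 'rV[R]_m)
    (y : nat -> R) (s0 : 'rV[R]_n -> R) (k : nat) : 'rV[R]_n -> R :=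
  match k with
  | 0 => s0
  | j.+1 => info_step (den j.+1) (u j) (y j.+1) (info_state den u y s0 j)
  end.

Definition original_state u y s0 k := info_state (fun=> phi sys) u y s0 k.

Definition gaslighted_state (g : nat -> R -> R) u y s0 k :=
  info_state g u y s0 k.

Definition admissible_controls (k : nat) (u : nat -> 'rV[R]_m) : Prop :=
  forall i, (i < k)%N -> ctrl sys i (u i).

(* [scen i] is the set of pairs (observation, gaslighting effort) regarded as
   possible at stage i. *)
Definition admissible_scenario (scen : nat -> set (R * (R -> R))) (k : nat)
    (y : nat -> R) (g : nat -> R -> R) : Prop :=
  forall i, (1 <= i <= k)%N ->
    [/\ scen i (y i, g i), is_pdf lebesgue_measure (g i),
        phi sys (y i) != 0 & g i (y i) != 0].

(* All information states, original (from [s0]) and gaslighted (from [sg0]),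
   at stages 0, ..., K.  The sets [scen] cannot be dropped: if every density
   were possible at every observation, g i (y i) could be arbitrarily small
   and the gaslighted states would have no maximal norm. *)
Definition possible_states (scen : nat -> set (R * (R -> R)))
    (s0 sg0 : 'rV[R]_n -> R) : set ('rV[R]_n -> R) :=
  [set s | exists j u y g,
    [/\ (j <= horizon sys)%N, admissible_controls j u,
        admissible_scenario scen j y g
      & s = original_state u y s0 j \/ s = gaslighted_state g u y sg0 j]].

End information_states.

(* Main.v *)
From HB Require Import structures.
Require Import Defs.
From mathcomp Require Import all_boot all_order all_algebra.
From mathcomp Require Import all_classical all_reals all_analysis.
From mathcomp Require Import measurable_realfun ring lra.
Import Order.TTheory GRing.Theory Num.Theory.
Import numFieldNormedType.Exports.
Local Open Scope classical_set_scope.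
Local Open Scope ring_scope.

(* With K(z, x) = psi (z - b(x, u)) e^(mu L(x, u)) phi (y - h x), one update of an
   information state s is the integral operator of kernel K applied to s / den y.
   By Tonelli and translation invariance of Lebesgue measure, K has column sums
   at most c, so the operator has L^1 operator norm at most c.  Splitting
     s1 / g y - s2 / phi y = s1 (1 / g y - 1 / phi y) + (s1 - s2) / phi y
   gives d_(j+1) <= c zeta Y_(j+1) + (c / phi y_(j+1)) d_j, and unrolling this
   linear recurrence yields the bound. *)

(** * Translation invariance on the real line *)

(** A measure giving each half-open interval its length is Lebesgue measure, and a translation maps
    such intervals to intervals of the same length. *)
Lemma lebesgue_measure_shift (R : realType) (t : R) (A : set (measurableTypeR R)) :
  measurable A ->
  pushforward lebesgue_measure (fun x : measurableTypeR R => x - t : measurableTypeR R) A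
  = lebesgue_measure A.
Proof.
have ms : measurable_fun [set: measurableTypeR R]
  (fun x : measurableTypeR R => x - t : measurableTypeR R).
  exact: measurable_funB.
pose sh : {mfun measurableTypeR R >-> measurableTypeR R} :=
  HB.pack (fun x : measurableTypeR R => x - t : measurableTypeR R)
    (isMeasurableFun.Build _ _ _ _ _ ms).
move=> mA; apply/esym.
apply: (@lebesgue_measure_unique R (pushforward lebesgue_measure sh)) => //.
move=> _ [[a b] /= _ <-]; rewrite /pushforward /=.
rewrite (_ : _ @^-1` _ = `]a + t, b + t]%classic); last first.
  by apply/seteqP; split=> x /=; rewrite !in_itv/=; lra.
by rewrite !lebesgue_measure_itv/= !lte_fin ltrD2r -!EFinB opprD addrACA subrr addr0.
Qed.

Lemma ge0_integral_lebesgue_shift (R : realType) (t : R)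
    (f : measurableTypeR R -> \bar R) :
  measurable_fun [set: measurableTypeR R] f -> (forall x, 0 <= f x)%E ->
  (\int[lebesgue_measure]_(x in [set: measurableTypeR R]) f (x - t)%R = \int[lebesgue_measure]_x f x)%E.
Proof.
move=> mf f0.
have ms : measurable_fun [set: measurableTypeR R]
  (fun x : measurableTypeR R => x - t : measurableTypeR R).
  exact: measurable_funB.
pose sh : {mfun measurableTypeR R >-> measurableTypeR R} :=
  HB.pack (fun x : measurableTypeR R => x - t : measurableTypeR R)
    (isMeasurableFun.Build _ _ _ _ _ ms).
rewrite -(@ge0_integral_pushforward _ _ _ _ _ _ ms lebesgue_measure setT)//.
apply: (@eq_measure_integral _ _ _ setT lebesgue_measure
  (pushforward lebesgue_measure sh)) => A mA _.
exact: lebesgue_measure_shift.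
Qed.

(** * Sigma-finiteness and iterated integrals in dimension n *)

(** [lebesgue_rV] is a recursively defined plain measure, whereas the Fubini-Tonelli lemmas expect a
    bundled sigma-finite one. This turns a proof of sigma-finiteness into that structure without
    changing the underlying function. *)
Definition sigma_finite_pack {d} {T : measurableType d} {R : realType}
    (mu : {measure set T -> \bar R}) (H : sigma_finite setT mu) :
  {sigma_finite_measure set T -> \bar R} :=
  HB.pack_for (SigmaFiniteMeasure.type T R) (Measure.sort mu)
    (@isSFinite.Build d T R mu (sfinite_measure_sigma_finite H))
    (@isSigmaFinite.Build d T R mu H).

(** The measurable inverse of [rV_cons]. It pulls boxes back to R^(n+1) and splits a translation
    vector into its scalar and n-dimensional parts. *)
Definition rV_uncons {R : realType} {n} (x : 'rV[R]_n.+1) :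
  measurableTypeR R * 'rV[R]_n := (x ord0 ord0, \row_j x ord0 (lift ord0 j)).

Lemma measurable_rV_uncons (R : realType) n :
  measurable_fun setT (@rV_uncons R n).
Proof.
apply/measurable_fun_pairP; split.
  exact: (measurable_rV_coor ord0).
apply/measurable_fun_rV_coorP => i.
rewrite (_ : _ \o _ = rV_coor (lift ord0 i)); first exact: measurable_rV_coor.
by apply/funext => x; rewrite /rV_coor/= mxE.
Qed.

Lemma rV_consK (R : realType) n : cancel (@rV_cons R n) (@rV_uncons R n).
Proof.
move=> [a x]; rewrite /rV_uncons /rV_cons; congr pair => /=.
  have -> : (ord0 : 'I_n.+1) = lshift n (ord0 : 'I_1) by exact/val_inj.
  by rewrite [LHS](row_mxEl (a : R)%:M x) mxE eqxx.
apply/rowP => j; rewrite mxE.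
have -> : lift ord0 j = rshift 1 j by exact/val_inj.
by rewrite [LHS](row_mxEr (a : R)%:M x).
Qed.

Lemma rV_unconsK (R : realType) n : cancel (@rV_uncons R n) (@rV_cons R n).
Proof.
move=> x; apply/rowP => i; rewrite /rV_cons /rV_uncons [LHS]mxE.
case: splitP => j ij; rewrite !mxE; last first.
  by congr (x _ _); exact/val_inj.
rewrite (ord1 j) eqxx mulr1n; congr (x _ _).
by apply/val_inj => /=; rewrite ij (ord1 j).
Qed.

Lemma rV_consB (R : realType) n (p : measurableTypeR R * 'rV[R]_n) t :
  rV_cons p - t = rV_cons (p.1 - (rV_uncons t).1, p.2 - (rV_uncons t).2).
Proof.
rewrite -[in LHS](rV_unconsK R n t); apply/rowP => i; rewrite /rV_cons.
by rewrite !mxE; case: fintype.split => j; rewrite !mxE ?mulrnBl.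
Qed.

Section cons_measure.
Context {R : realType} (n : nat).
Variable m : {sigma_finite_measure set 'rV[R]_n -> \bar R}.

(** Change of variables along [rV_cons], then Tonelli. The first coordinate is integrated innermost,
    so a translation can be removed there by the one-dimensional result. *)
Lemma ge0_integral_lebesgue_rV_cons (f : 'rV[R]_n.+1 -> \bar R) :
  measurable_fun setT f -> (forall x, 0 <= f x)%E ->
  (\int[lebesgue_rV_cons m]_z f z =
   \int[m]_x \int[lebesgue_measure]_a f (rV_cons (a, x)))%E.
Proof.
move=> mf f0.
have mc := @measurable_rV_cons R n.
have mfc : measurable_fun setT (f \o @rV_cons R n) by exact: measurableT_comp.
rewrite /lebesgue_rV_cons ge0_integral_pushforward// preimage_setT.
rewrite -(@fubini_tonelli2 _ _ _ _ R lebesgue_measure m _ mfc (fun=> f0 _)).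
(* The definition uses [\x^] and Tonelli uses [\x]; the two agree on rectangles, hence on all
   measurable sets. *)
apply: (@eq_measure_integral _ _ _ _ (lebesgue_measure \x m)%E) => A mA _.
apply/esym/product_measure_unique => //= B C mB mC.
exact: product_measure2E.
Qed.

(** Products of finite-measure covers of the two factors, transported by [rV_uncons], cover
    R^(n+1). *)
Lemma sigma_finite_lebesgue_rV_cons : sigma_finite setT (lebesgue_rV_cons m).
Proof.
have /sigma_finiteP[F [TF ndF Foo]] := sigma_finiteT (@lebesgue_measure R).
have /sigma_finiteP[G [TG ndG Goo]] := sigma_finiteT m.
exists (fun i => @rV_uncons R n @^-1` (F i `*` G i)).
  rewrite -preimage_bigcup (_ : \bigcup_i _ = setT) ?preimage_setT//.
  rewrite -setXTT TF TG; apply/seteqP; split=> [[x y] [i _ [Fx Gy]]|[x y]].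
    by split; exists i.
  (* The covers are nondecreasing, so the larger index serves both coordinates. *)
  move=> [[i _ Fx] [j _ Gy]]; exists (maxn i j) => //; split.
    by have /subsetPset := ndF _ _ (leq_maxl i j); exact.
  by have /subsetPset := ndG _ _ (leq_maxr i j); exact.
move=> i; have [mF Fi] := Foo i; have [mG Gi] := Goo i; split.
  rewrite -[X in measurable X]setTI; apply: measurable_rV_uncons => //.
  exact: measurableX.
rewrite /lebesgue_rV_cons /pushforward -comp_preimage.
rewrite (_ : _ \o _ = id); last by apply/funext => x; exact: rV_consK.
by rewrite preimage_id product_measure2E// lte_mul_pinfty// ge0_fin_numE.
Qed.

End cons_measure.

Lemma sigma_finite_lebesgue_rV (R : realType) n :
  sigma_finite setT (@lebesgue_rV R n).
Proof.
elim: n => [|n IH] /=; first exact: sigma_finiteT.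
exact: (sigma_finite_lebesgue_rV_cons n (sigma_finite_pack _ IH)).
Qed.

Definition lebesgue_rV_sigma_finite (R : realType) n :
  {sigma_finite_measure set 'rV[R]_n -> \bar R} :=
  sigma_finite_pack _ (sigma_finite_lebesgue_rV R n).

(** * Translation invariance on R^n *)

Lemma measurable_funB_rV {R : realType} d (T : measurableType d) n
    (f g : T -> 'rV[R]_n) :
  measurable_fun setT f -> measurable_fun setT g ->
  measurable_fun setT (fun x => f x - g x).
Proof.
move=> /measurable_fun_rV_coorP mf /measurable_fun_rV_coorP mg.
apply/measurable_fun_rV_coorP => i.
rewrite (_ : _ \o _ = (rV_coor i \o f) \- (rV_coor i \o g)).
  exact: measurable_funB.
by apply/funext => x; rewrite /rV_coor/= !mxE.
Qed.

(** Induction on the dimension: the scalar part of [t] is absorbed by the inner integral over the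
    line, the rest by the induction hypothesis. *)
Lemma ge0_integral_lebesgue_rV_shift (R : realType) n (t : 'rV[R]_n)
    (f : 'rV[R]_n -> \bar R) :
  measurable_fun setT f -> (forall x, 0 <= f x)%E ->
  (\int[lebesgue_rV n]_z f (z - t)%R = \int[lebesgue_rV n]_z f z)%E.
Proof.
elim: n => [|n IH] in t f *=> mf f0.
  (* R^0 has a single point. *)
  by apply: eq_integral => x _; congr f; apply/rowP; case.
have mft : measurable_fun setT (fun z : 'rV[R]_n.+1 => f (z - t)).
  by apply: measurableT_comp => //; exact: measurable_funB_rV.
have E := ge0_integral_lebesgue_rV_cons n (lebesgue_rV_sigma_finite R n).
rewrite /= (E _ mft)// (E _ mf)//.
have mfc : measurable_fun setT (f \o @rV_cons R n).
  by apply: measurableT_comp => //; exact: measurable_rV_cons.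
under eq_integral do under eq_integral do rewrite rV_consB /=.
under eq_integral => x _.
  rewrite (ge0_integral_lebesgue_shift _ _
    (fun a => f (rV_cons (a, x - (rV_uncons t).2))))//; last first.
    by apply: measurableT_comp => //; exact: measurableT_comp (@measurable_rV_cons R n) _.
  over.
(* The induction hypothesis is applied to [f] with its first coordinate integrated out; Tonelli
   supplies the measurability of that function. *)
rewrite (IH (rV_uncons t).2 (fun x => \int[lebesgue_measure]_a f (rV_cons (a, x)))%E)//.
  exact: (@measurable_fun_fubini_tonelli_G _ _ _ _ _ lebesgue_measure _ mfc (fun=> f0 _)).
by move=> x; apply: integral_ge0.
Qed.

(** * Integral operators on L^1 with bounded column integrals *)

Section kernel_operator.
Context {d} {T : measurableType d} {R : realType}.
Variable mu : {sigma_finite_measure set T -> \bar R}.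
Variables (K : T * T -> R) (C : R).
Hypothesis mK : measurable_fun setT K.
Hypothesis K0 : forall x, 0 <= K x.
Hypothesis C0 : 0 <= C.
Hypothesis KC : forall x, (\int[mu]_z (K (z, x))%:E <= C%:E)%E.

Definition kernel_op (s : T -> R) (z : T) : R :=
  (\int[mu]_x (K (z, x) * s x))%R.

Let Ks (s : T -> R) : T * T -> \bar R := fun p => (K p * s p.2)%:E.

Let mKs s : mu.-integrable setT (EFin \o s) -> measurable_fun setT (Ks s).
Proof.
move=> /measurable_int/measurable_EFinP ms; apply/measurable_EFinP.
apply: measurable_funM => //; exact: measurableT_comp ms measurable_snd.
Qed.

(** Tonelli exchanges the integrals; then |s x| leaves the integral over z, and what remains is a
    column integral, at most [C]. *)
Let int_abs_Ks s : mu.-integrable setT (EFin \o s) ->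
  (\int[mu]_z \int[mu]_x `|Ks s (z, x)| <= C%:E * \int[mu]_x `|(s x)%:E|)%E.
Proof.
move=> is_; have ms := measurable_int _ is_.
have mas : measurable_fun setT (fun x => `|(s x)%:E|%E) by exact: measurableT_comp ms.
have maKs : measurable_fun setT (fun p => `|Ks s p|%E).
  by apply: measurableT_comp => //; exact: mKs.
rewrite (@fubini_tonelli _ _ _ _ _ mu mu _ maKs)//.
rewrite -ge0_integralZl//; apply: ge0_le_integral => //.
- by move=> x _; exact: integral_ge0.
- exact: (@measurable_fun_fubini_tonelli_G _ _ _ _ _ mu _ maKs).
- exact: measurable_funeM.
- move=> x _.
  rewrite (eq_integral (fun z => `|(s x)%:E| * (K (z, x))%:E)%E); last first.
    move=> z _; rewrite /Ks EFinM abseM muleC; congr (_ * _)%E.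
    by rewrite gee0_abs// lee_fin.
  rewrite ge0_integralZl//; last 2 first.
  - by apply/measurable_EFinP; exact: measurableT_comp mK (measurable_pair2 _).
  - by move=> z _; rewrite lee_fin.
  by rewrite muleC; apply: lee_wpmul2r.
Qed.

(** Joint integrability gives, through Fubini, the measurability of [kernel_op s] and the
    integrability of almost every section in x. *)
Let integrable_Ks s : mu.-integrable setT (EFin \o s) ->
  (mu \x mu)%E.-integrable setT (Ks s).
Proof.
move=> is_; apply/integrable12ltyP; first exact: mKs.
apply: le_lt_trans (int_abs_Ks s is_) _.
have /integrableP[_ soo] := is_.
by rewrite lte_mul_pinfty.
Qed.

Lemma measurable_kernel_op s : mu.-integrable setT (EFin \o s) ->
  measurable_fun setT (kernel_op s).
Proof.
move=> is_; rewrite /kernel_op /Rintegral.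
apply: measurableT_comp => //.
exact: (measurable_int _ (integrable_fubini_F (integrable_Ks s is_))).
Qed.

Lemma kernel_op_L1_le s : mu.-integrable setT (EFin \o s) ->
  (\int[mu]_z `|(kernel_op s z)%:E| <= C%:E * \int[mu]_x `|(s x)%:E|)%E.
Proof.
move=> is_; apply: le_trans (int_abs_Ks s is_).
have maKs : measurable_fun setT (fun p => `|Ks s p|%E).
  by apply: measurableT_comp => //; exact: mKs.
apply: ge0_le_integral => //.
- apply: measurableT_comp => //.
  by apply/measurable_EFinP; exact: measurable_kernel_op.
- exact: (@measurable_fun_fubini_tonelli_F _ _ _ _ _ mu _ maKs).
move=> z _; apply: (@le_trans _ _ (`|\int[mu]_x Ks s (z, x)|)%E).
  rewrite /kernel_op /Rintegral /Ks/=.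
  (* Where the integral is infinite, [fine] returns 0, which is still below its absolute value
     +oo. *)
  by case: (\int[mu]_x _)%E => //=; rewrite ?leey// normr0 leey.
apply: le_abse_integral => //.
exact: measurableT_comp (mKs s is_) (measurable_pair1 _).
Qed.

Lemma integrable_kernel_op s : mu.-integrable setT (EFin \o s) ->
  mu.-integrable setT (EFin \o kernel_op s).
Proof.
move=> is_; apply/integrableP; split.
  by apply/measurable_EFinP; exact: measurable_kernel_op.
apply: le_lt_trans (kernel_op_L1_le s is_) _.
by have /integrableP[_ soo] := is_; rewrite lte_mul_pinfty.
Qed.

(* [kernel_op] is linear only almost everywhere: where the integrals diverge,
   [fine] returns the junk value 0. *)
Lemma kernel_opB_L1_le s1 s2 :
  mu.-integrable setT (EFin \o s1) -> mu.-integrable setT (EFin \o s2) ->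
  (\int[mu]_z `|(kernel_op s1 z - kernel_op s2 z)%:E| <=
   C%:E * \int[mu]_x `|(s1 x - s2 x)%:E|)%E.
Proof.
move=> is1 is2.
have isB : mu.-integrable setT (EFin \o (fun x => s1 x - s2 x)).
  exact: integrableB is1 is2.
apply: le_trans (kernel_op_L1_le _ isB); rewrite le_eqVlt; apply/orP; left.
apply/eqP/ge0_ae_eq_integral => //.
- apply: measurableT_comp => //; apply/measurable_EFinP.
  by apply: measurable_funB; exact: measurable_kernel_op.
- apply: measurableT_comp => //; apply/measurable_EFinP.
  exact: measurable_kernel_op.
(* For almost every z both sections are integrable, so the real-valued integral is additive
   there. *)
have := ae_integrable1 (integrable_Ks _ is1).
have := ae_integrable1 (integrable_Ks _ is2).
apply: filterS2 => z i2 i1 _; congr (`|_%:E|)%E.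
rewrite /kernel_op -RintegralB//; apply: eq_Rintegral => x _; exact/esym/mulrBr.
Qed.

End kernel_operator.

(** * One update of an information state *)

Section info_step.
Context {R : realType} {n m : nat}.
Variables (sys : risk_system R n m) (phihat l : R) (u : 'rV[R]_m).
Hypothesis psi_pdf : is_pdf (lebesgue_rV n) (psi sys).
Hypothesis mphi : measurable_fun setT (phi sys).
Hypothesis phi_ge0 : forall y, 0 <= phi sys y.
Hypothesis phi_le : forall y, phi sys y <= phihat.
Hypothesis mdyn : measurable_fun setT (fun x => dyn sys x u).
Hypothesis mobs : measurable_fun setT (obs sys).
Hypothesis mcost : measurable_fun setT (fun x => cost sys x u).
Hypothesis cost_le : forall x, expR (risk sys * cost sys x u) <= l.

Let mu : {sigma_finite_measure set 'rV[R]_n -> \bar R} :=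
  lebesgue_rV_sigma_finite R n.

(** The denominator is left out, so one kernel serves both the original and the gaslighted update;
    [psi] is kept apart as the only factor depending on z. *)
Definition info_kernel (y : R) (p : 'rV[R]_n * 'rV[R]_n) : R :=
  psi sys (p.1 - dyn sys p.2 u) *
  (expR (risk sys * cost sys p.2 u) * phi sys (y - obs sys p.2)).

Let c_ge0 : 0 <= phihat * l.
Proof.
apply: mulr_ge0; first exact: le_trans (phi_ge0 0) (phi_le 0).
exact: le_trans (expR_ge0 _) (cost_le 0).
Qed.

Let measurable_info_kernel y : measurable_fun setT (info_kernel y).
Proof.
have [mpsi _ _] := psi_pdf.
apply: measurable_funM.
  apply: measurableT_comp => //; apply: measurable_funB_rV => //.
  exact: measurableT_comp mdyn measurable_snd.
apply: measurable_funM.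
  apply: measurableT_comp => //; apply: measurable_funM => //.
  exact: measurableT_comp mcost measurable_snd.
apply: measurableT_comp => //; apply: measurable_funB => //.
exact: measurableT_comp mobs measurable_snd.
Qed.

Let info_kernel_ge0 y p : 0 <= info_kernel y p.
Proof.
have [_ psi0 _] := psi_pdf.
by rewrite /info_kernel !mulr_ge0// expR_ge0.
Qed.

(** For fixed x the factors without z come out of the integral and are at most [phihat * l]; the
    translated density [psi] has mass 1. *)
Let integral_info_kernel y x :
  (\int[mu]_z (info_kernel y (z, x))%:E <= (phihat * l)%:E)%E.
Proof.
have [mpsi psi0 psi1] := psi_pdf.
rewrite /info_kernel /=; under eq_integral do rewrite EFinM muleC.
have mpsi' : measurable_fun setT (EFin \o psi sys) by exact/measurable_EFinP.
rewrite ge0_integralZl//.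
- rewrite (ge0_integral_lebesgue_rV_shift R n (dyn sys x u) (EFin \o psi sys))//=.
  rewrite psi1 mule1 lee_fin mulrC; exact: ler_pM (phi_ge0 _) (expR_ge0 _) _ _.
- apply/measurable_EFinP; apply: (measurableT_comp mpsi).
  exact: measurable_funB_rV.
- by move=> z _; rewrite lee_fin.
- by rewrite lee_fin mulr_ge0// expR_ge0.
Qed.

Let info_stepE den y s :
  info_step sys den u y s = kernel_op mu (info_kernel y) (fun x => s x / den y).
Proof.
apply/funext => z; apply: eq_Rintegral => x _.
by rewrite /info_kernel/=; ring.
Qed.

Let measurable_div (s : 'rV[R]_n -> R) (a : R) :
  measurable_fun setT (EFin \o s) -> measurable_fun setT (fun x => s x / a).
Proof. by move=> /measurable_EFinP ms; exact: measurable_funM. Qed.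

Let integrable_div (s : 'rV[R]_n -> R) (a : R) :
  mu.-integrable setT (EFin \o s) ->
  mu.-integrable setT (EFin \o (fun x => s x / a)).
Proof.
move=> is_; have := @integrableZr _ _ _ mu setT measurableT a^-1 _ is_.
by apply: eq_integrable => // x _; rewrite /= EFinM.
Qed.

Lemma integrable_info_step den y s :
  mu.-integrable setT (EFin \o s) ->
  mu.-integrable setT (EFin \o info_step sys den u y s).
Proof.
move=> is_; rewrite info_stepE.
exact: (integrable_kernel_op mu _ _ _ _ c_ge0 (integral_info_kernel y) _
  (integrable_div _ _ is_)).
Qed.

(** The splitting is asymmetric: the discrepancy of the denominators multiplies [s1], later the
    gaslighted state with norm at most [zeta], and the difference of states keeps the weight of
    [den2], later [phi]. *)
Lemma info_stepB_L1_le den1 den2 y s1 s2 :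
  mu.-integrable setT (EFin \o s1) -> mu.-integrable setT (EFin \o s2) ->
  0 <= den2 y ->
  (L1dist (info_step sys den1 u y s1) (info_step sys den2 u y s2) <=
   (phihat * l * `|1 / den1 y - 1 / den2 y|)%:E * L1norm s1 +
   (phihat * l / den2 y)%:E * L1dist s1 s2)%E.
Proof.
move=> is1 is2 den0.
have ms1 := measurable_int _ is1; have ms2 := measurable_int _ is2.
have ms12 : measurable_fun setT (fun x => (s1 x - s2 x)%:E).
  by apply/measurable_EFinP/measurable_funB; exact/measurable_EFinP.
rewrite /L1dist /L1norm !Lnorm1 !info_stepE.
apply: le_trans (kernel_opB_L1_le mu _ _ (measurable_info_kernel y)
  (info_kernel_ge0 y) c_ge0 (integral_info_kernel y) _ _
  (integrable_div _ _ is1) (integrable_div _ _ is2)) _.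
(* The common factor [phihat * l] is taken out of both terms, leaving an L^1 estimate on the
   operator's arguments. *)
rewrite (EFinM _ `|_|) (EFinM _ (den2 y)^-1) -!(muleA (phihat * l)%:E).
rewrite -ge0_muleDr; last 2 first.
- by rewrite mule_ge0// integral_ge0.
- by rewrite mule_ge0 ?lee_fin ?invr_ge0// integral_ge0.
apply: lee_wpmul2l; first by rewrite lee_fin.
have mas1 : measurable_fun setT (fun x => `|(s1 x)%:E|%E).
  exact: measurableT_comp ms1.
have mas12 : measurable_fun setT (fun x => `|(s1 x - s2 x)%:E|%E).
  exact: measurableT_comp ms12.
rewrite -ge0_integralZl// -[X in (_ <= _ + X)%E]ge0_integralZl// ?lee_fin ?invr_ge0//.
rewrite -ge0_integralD//; last 3 first.
- exact: measurable_funeM.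
- by move=> x _; rewrite mule_ge0 ?lee_fin ?invr_ge0.
- exact: measurable_funeM.
apply: ge0_le_integral => //.
- apply: measurableT_comp => //; apply/measurable_EFinP; apply: measurable_funB.
    exact: measurable_div ms1.
  exact: measurable_div ms2.
- by apply: emeasurable_funD; exact: measurable_funeM.
- move=> x _; rewrite -!EFinM -EFinD lee_fin.
  (* Since [den2 y] is nonnegative, its inverse can go under the absolute value, and the pointwise
     claim becomes the triangle inequality. *)
  rewrite -[X in _ <= _ + X * _]ger0_norm ?invr_ge0// -!normrM.
  rewrite (_ : _ - _ = (1 / den1 y - 1 / den2 y) * s1 x + (den2 y)^-1 * (s1 x - s2 x)).
    exact: ler_normD.
  by ring.
Qed.

End info_step.

(** * The linear recurrence and the final bound *)

(** Multiplying the bound at k by c / p_(k+1) raises each power of c by one and extends each product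
    by p_(k+1); the new source term becomes the summand j = k+1. *)
Lemma linear_recurrence_bound (R : realFieldType) (c zeta : R)
    (p Y D : nat -> R) (k : nat) :
  0 <= c -> (forall j, (j < k)%N -> 0 <= p j.+1) ->
  (forall j, (j < k)%N -> D j.+1 <= c * zeta * Y j.+1 + c / p j.+1 * D j) ->
  D k <= c ^+ k / \prod_(1 <= i < k.+1) p i * D 0%N
    + \sum_(1 <= j < k.+1)
        c ^+ (k - j + 1) * zeta * Y j / \prod_(j.+1 <= i < k.+1) p i.
Proof.
move=> c0; elim: k => [|k IH] p0 step.
  by rewrite !big_geq// expr0 divr1 mul1r addr0.
apply: le_trans (step k (ltnSn _)) _.
(* The last summand has exponent 1 and an empty product, so it equals the source term of the
   recurrence and cancels. *)
rewrite (big_nat_recr k.+1 1)//= (big_nat_recr k.+1 1)//= subnn expr1 [\prod_(k.+2 <= i < k.+2) _]big_geq// divr1.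
rewrite [leRHS]addrA [leLHS]addrC lerD2r.
have ck0 : 0 <= c / p k.+1 by rewrite divr_ge0// p0.
apply: le_trans (ler_wpM2l ck0 (IH _ _)) _.
- by move=> j jk; rewrite p0// ltnW.
- by move=> j jk; rewrite step// ltnW.
rewrite mulrDr mulr_sumr lerD//.
  by rewrite exprS invfM le_eqVlt; apply/orP; left; apply/eqP; ring.
rewrite le_eqVlt; apply/orP; left; apply/eqP; apply: eq_big_nat => j /andP[j0 jk].
rewrite [in RHS]big_nat_recr//= subSn// addSn exprS invfM; ring.
Qed.

Theorem theorem1 (R : realType) (n m : nat) (sys : risk_system R n m)
  (s0 sg0 : 'rV[R]_n -> R) (scen : nat -> set (R * (R -> R)))
  (phihat l c zeta : R)
  (psi_pdf : is_pdf (lebesgue_rV n) (psi sys))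
  (phi_pdf : is_pdf lebesgue_measure (phi sys))
  (dyn_meas : forall u, control_values sys u ->
     measurable_fun [set: 'rV[R]_n] (fun x => dyn sys x u))
  (obs_meas : measurable_fun [set: 'rV[R]_n] (obs sys))
  (cost_meas : forall u, control_values sys u ->
     measurable_fun [set: 'rV[R]_n] (fun x => cost sys x u))
  (ctrl_compact : forall i, (i <= horizon sys)%N -> compact (ctrl sys i))
  (risk_gt0 : 0 < risk sys)
  (s0_pdf : is_pdf (lebesgue_rV n) s0)
  (sg0_L1 : (lebesgue_rV n).-integrable [set: 'rV[R]_n] (EFin \o sg0))
  (phihat_max : is_max (range (phi sys)) phihat)
  (l_max : is_max [set expR (risk sys * cost sys x u) |
                    x in [set: 'rV[R]_n] & u in control_values sys] l)
  (c_def : c = phihat * l)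
  (zeta_gt0 : 0 < zeta)
  (zeta_max : is_max (@L1norm R n @` possible_states sys scen s0 sg0) zeta%:E)
  (k : nat) (k_range : (1 <= k <= horizon sys)%N)
  (y : nat -> R) (g : nat -> R -> R)
  (scenario : admissible_scenario sys scen k y g)
  (u : nat -> 'rV[R]_m) (controls : admissible_controls sys k u) :
  let d j := L1dist (gaslighted_state sys g u y sg0 j)
                    (original_state sys u y s0 j) in
  let Y j := `| 1 / g j (y j) - 1 / phi sys (y j) | in
  (d k <= (c ^+ k / \prod_(1 <= i < k.+1) phi sys (y i))%:E * d 0%N
     + (\sum_(1 <= j < k.+1)
          c ^+ (k - j + 1) * zeta * Y j
            / \prod_(j.+1 <= i < k.+1) phi sys (y i))%:E)%E.
Proof.
have [_ phi0 _] := phi_pdf; have [mphi _ _] := phi_pdf.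
have phi_le z : phi sys z <= phihat by case: phihat_max => _; apply; exists z.
have [k_gt0 kK] := andP k_range.
have uV i : (i < k)%N -> control_values sys (u i).
  by move=> ik; exists i; [exact: leq_trans ik kK|exact: controls].
have cost_le i : (i < k)%N -> forall x, expR (risk sys * cost sys x (u i)) <= l.
  by move=> ik x; case: l_max => _; apply; exists x => //; exists (u i) => //; exact: uV.
(* As k is at least 1, [u 0] is an admissible control value, and the cost bound there shows [l]
   nonnegative. *)
have c0 : 0 <= c.
  rewrite c_def mulr_ge0 ?(le_trans (phi0 0) (phi_le 0))//.
  exact: le_trans (expR_ge0 _) (cost_le 0%N k_gt0 0).
have istep i := fun ik : (i < k)%N => integrable_info_step sys phihat l (u i)
  psi_pdf mphi phi0 phi_le (dyn_meas _ (uV i ik)) obs_meas (cost_meas _ (uV i ik))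
  (cost_le i ik).
(* Stated for arbitrary denominators and initial state, so that it covers both sequences. *)
have int_state den s j : (lebesgue_rV n).-integrable setT (EFin \o s) ->
    (j <= k)%N ->
    (lebesgue_rV n).-integrable setT (EFin \o info_state sys den u y s j).
  by move=> is_; elim: j => [//|j IH] jk; apply: istep => //; exact/IH/ltnW.
have s0_L1 : (lebesgue_rV n).-integrable setT (EFin \o s0).
  have [ms0 s0_ge0 s01] := s0_pdf; apply/integrableP; split.
    exact/measurable_EFinP.
  rewrite (eq_integral (EFin \o s0)); first by rewrite s01 ltry.
  by move=> x _; rewrite /= ger0_norm.
lazy zeta.
set d := (fun j : nat => L1dist _ _); set Y := (fun j : nat => `| _ |).
(* Integrability makes the extended-real distances finite, so the recurrence can be solved over the
   reals. *)
have d_fin j : (j <= k)%N -> d j = (fine (d j))%:E.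
  move=> jk; rewrite fineK// /d /L1dist /L1norm Lnorm1 ge0_fin_numE ?integral_ge0//.
  have /integrableP[] := integrableB measurableT
    (int_state g sg0 j sg0_L1 jk) (int_state (fun=> phi sys) s0 j s0_L1 jk).
  by [].
have step j : (j < k)%N ->
    fine (d j.+1) <= c * zeta * Y j.+1 + c / phi sys (y j.+1) * fine (d j).
  move=> jk; rewrite -lee_fin EFinD (EFinM (_ / _)) -!d_fin//; last exact: ltnW.
  apply: le_trans (info_stepB_L1_le sys phihat l (u j) psi_pdf mphi phi0 phi_le
    (dyn_meas _ (uV j jk)) obs_meas (cost_meas _ (uV j jk)) (cost_le j jk)
    (g j.+1) (phi sys) (y j.+1) _ _ (int_state g sg0 j sg0_L1 (ltnW jk))
    (int_state (fun=> phi sys) s0 j s0_L1 (ltnW jk)) (phi0 _)) _.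
  rewrite -c_def leeD2r// (mulrAC c zeta) (EFinM (c * _) zeta) lee_wpmul2l//.
    by rewrite lee_fin mulr_ge0.
  (* The gaslighted state of stage j is a possible state: the given controls, observations and
     efforts remain admissible when restricted to the first j stages. *)
  case: zeta_max => _; apply; exists (gaslighted_state sys g u y sg0 j) => //.
  exists j, u, y, g; split; [exact: leq_trans (ltnW jk) kK| | |by right].
    by move=> i ij; apply: controls; exact: ltn_trans jk.
  move=> i /andP[i1 ij]; apply: scenario; rewrite i1/=.
  exact: leq_trans ij (ltnW jk).
rewrite (d_fin k)// (d_fin 0%N)// -EFinM -EFinD lee_fin.
exact: (linear_recurrence_bound R c zeta (fun i => phi sys (y i)) Y
  (fun j => fine (d j)) k c0 (fun j _ => phi0 _) step).
Qed.
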